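(* Let $\alpha\in[0,1)$ and let $G$ be a connected graph of order $n$ with $n\geq f(\alpha)$. If $\rho_{\alpha}(G)>\eta(n)$, then $G$ is a $P_{\geq2}$-factor covered graph.
   Context: All graphs are finite, simple and undirected. For a graph $G$, $D(G)$ is the diagonal matrix of vertex degrees and $A(G)$ the adjacency matrix; for $\alpha\in[0,1)$, $A_{\alpha}(G)=\alpha D(G)+(1-\alpha)A(G)$, and $\rho_{\alpha}(G)$ denotes the largest eigenvalue of $A_{\alpha}(G)$. A path factor of $G$ is a spanning subgraph each of whose components is a path with at least two vertices; a $P_{\geq k}$-factor is a path factor in which every component has at least $k$ vertices. $G$ is a $P_{\geq k}$-factor covered graph if for every edge $e\in E(G)$ there is a $P_{\geq k}$-factor of $G$ containing $e$. Define $f(\alpha)=14$ if $\alpha\in[0,\frac12]$, $f(\alpha)=17$ if $\alpha\in(\frac12,\frac23]$, $f(\alpha)=20$ if $\alpha\in(\frac23,\frac34]$, and $f(\alpha)=\frac{5}{1-\alpha}+1$ if $\alpha\in(\frac34,1)$. Let $\eta(n)$ be the largest root of $x^{3}-((\alpha+1)n+\alpha-4)x^{2}+(\alpha n^{2}+(\alpha^{2}-2\alpha-1)n-2\alpha+1)x-\alpha^{2}n^{2}+(5\alpha^{2}-3\alpha+2)n-10\alpha^{2}+15\alpha-8=0$. *)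

(* Defs.v *)
From HB Require Import structures.
From mathcomp Require Import all_boot all_order all_algebra.
From mathcomp Require Import reals.
Set Implicit Arguments. Unset Strict Implicit. Unset Printing Implicit Defensive.
Import Order.TTheory GRing.Theory Num.Theory.
Local Open Scope ring_scope.

Definition simple_graph (n : nat) (g : rel 'I_n) : Prop :=
  symmetric g /\ irreflexive g.

Definition connected_graph (n : nat) (g : rel 'I_n) : Prop :=
  forall x y : 'I_n, connect g x y.

Definition deg (n : nat) (g : rel 'I_n) (v : 'I_n) : nat := #|[set u | g v u]|.

Definition A_alpha (R : nzRingType) (n : nat) (g : rel 'I_n) (alpha : R) : 'M[R]_n :=
  \matrix_(i, j) (alpha * ((i == j)%:R * (deg g i)%:R) + (1 - alpha) * (g i j)%:R).

Definition largest_eigenvalue (R : realFieldType) (n : nat) (M : 'M[R]_n) (rho : R) : Prop :=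
  eigenvalue M rho /\ forall mu, eigenvalue M mu -> mu <= rho.

Definition seq_adj (T : eqType) (s : seq T) (x y : T) : Prop :=
  exists2 i : nat, (i.+1 < size s)%N &
    ((nth x s i = x /\ nth x s i.+1 = y) \/ (nth x s i = y /\ nth x s i.+1 = x)).

(* F is a spanning subgraph of g all of whose components are paths with
   at least k vertices: every vertex v lies on a sequence s of distinct
   vertices, |s| >= k, such that the F-edges at vertices of s are exactly
   the consecutive pairs of s (so the component of v in F is the path s). *)
Definition P_ge_k_factor (n : nat) (g : rel 'I_n) (k : nat) (F : rel 'I_n) : Prop :=
  symmetric F /\ (forall x y, F x y -> g x y) /\
  forall v : 'I_n, exists s : seq 'I_n,
    [/\ v \in s, uniq s, (k <= size s)%N &
        forall x y, x \in s -> (F x y <-> seq_adj s x y)].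

Definition P_ge_k_factor_covered (n : nat) (g : rel 'I_n) (k : nat) : Prop :=
  forall x y, g x y -> exists F, P_ge_k_factor g k F /\ F x y.

Definition f_alpha (R : realFieldType) (alpha : R) : R :=
  if alpha <= 2^-1 then 14
  else if alpha <= 2/3 then 17
  else if alpha <= 3/4 then 20
  else 5 / (1 - alpha) + 1.

Definition eta_poly (R : nzRingType) (alpha : R) (n : nat) : {poly R} :=
  let N := (n%:R : R) in
  'X^3 - ((alpha + 1) * N + alpha - 4)%:P * 'X^2
  + (alpha * N ^+ 2 + (alpha ^+ 2 - 2 * alpha - 1) * N - 2 * alpha + 1)%:P * 'X
  + (- alpha ^+ 2 * N ^+ 2 + (5 * alpha ^+ 2 - 3 * alpha + 2) * N
     - 10 * alpha ^+ 2 + 15 * alpha - 8)%:P.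

Definition largest_root (R : realFieldType) (p : {poly R}) (eta : R) : Prop :=
  root p eta /\ forall x, root p x -> x <= eta.

(* Main.v *)
(* If an edge [xy] is not covered, Hall's theorem provides an independent set
   [I] with neighbourhood [S] such that either [#|S| = 1] and [#|I| >= 2], or
   [#|S| >= 2] and [#|I| >= 2 * #|S| - 1]. Indeed, otherwise there is a map [f]
   sending every vertex to a neighbour, exchanging [x] and [y], and taking each
   value at most twice; among these maps, one with as many 2-cycles as possible
   has all its edges in short paths around its 2-cycles.

   Any such pair [S], [I] bounds the spectral radius: a positive vector [z]
   constant on [S], on [I] and on the other vertices with [A_alpha z <= lam z]
   forces every eigenvalue to be at most [lam]. For [#|S| = 1] the Perron vector
   of [K_1 \/ (K_(n-3) u 2 K_1)] gives [lam = eta]; for [#|S| >= 2] the values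
   [3 - 2 alpha] on [S] and [2 (1 - alpha)] elsewhere give [lam = n - 3 <= eta]. *)
Require Import Defs.
From HB Require Import structures.
From mathcomp Require Import all_boot all_order all_algebra.
From mathcomp Require Import reals.
From mathcomp Require Import ring lra zify.
Import Order.TTheory GRing.Theory Num.Theory.

(** * Hall's marriage theorem *)

(* Rado's argument: in an inclusion-minimal family satisfying Hall's condition
   every member is a singleton. *)
Lemma hall_marriage (T U : finType) (u0 : U) (D : {set T}) (A : {ffun T -> {set U}}) :
  (forall X : {set T}, X \subset D -> #|X| <= #|\bigcup_(t in X) A t|) ->
  exists f : T -> U, {in D &, injective f} /\ {in D, forall t, f t \in A t}.
Proof.
have [k] := ubnP (\sum_t #|A t|); elim: k A => // k IHk A leAk hallA.
have [single|] := boolP [forall t in D, #|A t| <= 1].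
  pose f t := odflt u0 [pick u in A t].
  have fA t : t \in D -> A t = [set f t].
    move=> tD; have /cards1P[u Atu] : #|A t| == 1.
      rewrite eqn_leq (forall_inP single) //=.
      by have := hallA [set t]; rewrite sub1set cards1 big_set1; apply.
    rewrite /f; case: pickP => [w|/(_ u)]; rewrite Atu ?set11 //.
    by rewrite inE => /eqP->.
  exists f; split=> [t1 t2 t1D t2D eqf|t tD]; last by rewrite fA ?set11.
  apply/eqP; apply: contraT => neq12.
  have := hallA [set t1; t2]; rewrite subUset !sub1set t1D t2D cards2 neq12.
  by rewrite bigcup_setU !big_set1 !fA // eqf setUid cards1; apply.
case/forall_inPn => t0 t0D; rewrite -ltnNge => /card_gt1P[u1 [u2 [u1A u2A neq12]]].
pose B u := [ffun t => if t == t0 then A t :\ u else A t].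
have ltB u : u \in A t0 -> \sum_t #|B u t| < k.
  move=> uA; apply: leq_trans (leAk : \sum_t #|A t| <= k).
  rewrite (bigD1 t0) //= [ltnRHS](bigD1 t0) //= ffunE eqxx.
  have -> : \sum_(t | t != t0) #|B u t| = \sum_(t | t != t0) #|A t|.
    by apply: eq_bigr => t /negbTE tt0; rewrite ffunE tt0.
  by rewrite ltn_add2r [ltnRHS](cardsD1 u) uA.
have sBA u : (exists f : T -> U, {in D &, injective f} /\ {in D, forall t, f t \in B u t}) ->
    exists f : T -> U, {in D &, injective f} /\ {in D, forall t, f t \in A t}.
  case=> f [injf fB]; exists f; split=> // t /fB; rewrite ffunE.
  by case: ifP => // _ /setD1P[].
(* Deleting an element of [A t0] can only break Hall's condition on sets that contain [t0]. *)
pose bad u (X : {set T}) :=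
  [&& X \subset D, t0 \in X & #|\bigcup_(t in X) B u t| < #|X|].
have goodP u : u \in A t0 -> bad u =1 xpred0 ->
    exists f : T -> U, {in D &, injective f} /\ {in D, forall t, f t \in A t}.
  move=> uA nobad; apply/(sBA u)/IHk => [|X sXD]; first exact: ltB.
  rewrite leqNgt; apply/negP => ltX.
  have [t0X|t0X] := boolP (t0 \in X).
    by have := nobad X; rewrite /bad sXD t0X ltX.
  move: ltX; rewrite ltnNge => /negP[].
  have -> : \bigcup_(t in X) B u t = \bigcup_(t in X) A t.
    apply: eq_bigr => t tX; rewrite ffunE; case: eqP => // tt0.
    by rewrite -tt0 tX in t0X.
  exact: hallA.
have [|/goodP] := pickP (bad u1); last exact.
move=> X1 /and3P[sX1 tX1 ltX1].
have [|/goodP] := pickP (bad u2); last exact.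
move=> X2 /and3P[sX2 tX2 ltX2]; exfalso.
(* Submodularity: as [u1 != u2], the two reduced copies of [A t0] together cover [A t0], so the
   bounds [leU] and [leI] add up to [#|X1| + #|X2| - 1 <= #|N1| + #|N2|], whereas each [Ni] has
   fewer elements than [Xi]. *)
set N1 := \bigcup_(t in X1) B u1 t in ltX1.
set N2 := \bigcup_(t in X2) B u2 t in ltX2.
have leU : #|X1 :|: X2| <= #|N1 :|: N2|.
  apply: leq_trans (hallA _ _) (subset_leq_card _); first by rewrite subUset sX1.
  apply/bigcupsP => t tX; apply/subsetP => u uA; rewrite inE.
  have [tt0|tt0] := eqVneq t t0.
    subst t; have [uu1|uu1] := eqVneq u u1; apply/orP; [right|left]; apply/bigcupP.
      by exists t0; rewrite // ffunE eqxx !inE uu1 neq12 u1A.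
    by exists t0; rewrite // ffunE eqxx !inE uu1 uA.
  case/setUP: tX => tX; apply/orP; [left|right]; apply/bigcupP; exists t => //.
    by rewrite ffunE (negbTE tt0).
  by rewrite ffunE (negbTE tt0).
have leI : #|(X1 :&: X2) :\ t0| <= #|N1 :&: N2|.
  apply: leq_trans (hallA _ _) (subset_leq_card _).
    by apply: subset_trans (subsetDl _ _) _; apply: subset_trans sX1; apply: subsetIl.
  apply/bigcupsP => t /setD1P[/negbTE tt0 /setIP[t1 t2]]; apply/subsetP => u uA.
  by rewrite inE; apply/andP; split; apply/bigcupP; exists t; rewrite // ffunE tt0.
have := cardsUI X1 X2; have := cardsUI N1 N2.
have := cardsD1 t0 (X1 :&: X2); rewrite inE tX1 tX2 /=.
lia.
Qed.

(** * Maps to neighbours and the path factors they draw *)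

(* Take [h] with as many 2-cycles as possible. A vertex outside the 2-cycles
   with a preimage having at most one preimage could be redirected to it, making
   a new 2-cycle. So all preimages of the set [B] of non-leaves outside the
   2-cycles lie in [B] and have exactly two preimages, whence [#|B| >= 2 * #|B|]
   and [B] is empty. *)
Lemma two_cycle_map (T : finType) (e : rel T) (f : T -> T) (x y : T) :
  symmetric e -> (forall v, e v (f v)) -> (forall u, #|[set v | f v == u]| <= 2) ->
  f x = y -> f y = x ->
  exists h : T -> T, [/\ forall v, e v (h v), forall u, #|[set v | h v == u]| <= 2,
    h x = y, h y = x & forall v, h (h (h v)) = h v].
Proof.
move=> esym ef fib fx fy.
pose ok (h : {ffun T -> T}) := [&& [forall v, e v (h v)],
  [forall u, #|[set v | h v == u]| <= 2], h x == y & h y == x].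
pose cyc (h : {ffun T -> T}) := [set v | h (h v) == v].
have ok0 : ok (finfun f).
  apply/and4P; split; rewrite ?ffunE ?fx ?fy //; apply/forallP => v; rewrite ?ffunE //.
  by under eq_finset do rewrite ffunE.
case: (arg_maxnP (fun h => #|cyc h|) ok0) => h.
case/and4P=> /forallP eh /forallP fibh /eqP hx /eqP hy hmax.
exists h; split=> //.
have two w w1 : h (h w) != w -> h w1 = w -> #|[set v | h v == w1]| = 2.
  move=> w_nc hw1; apply/eqP; rewrite eqn_leq fibh /= leqNgt; apply/negP => lt2.
  pose h' := [ffun v => if v == w then w1 else h v].
  have w1w : w1 != w.
    by apply: contraNneq w_nc => ww; have := hw1; rewrite ww => hww; rewrite !hww.
  have hcyc v : h (h v) = v -> v != w.
    by move=> hv; apply: contraNneq w_nc => <-; rewrite hv.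
  have ok' : ok h'.
    apply/and4P; split.
    - apply/forallP => v; rewrite ffunE; case: eqP => [->|//].
      by rewrite esym; have := eh w1; rewrite hw1.
    - apply/forallP => u; have [->|uw1] := eqVneq u w1.
        apply: leq_trans (_ : #|w |: [set v | h v == w1]| <= 2).
          apply/subset_leq_card/subsetP => v; rewrite !inE ffunE.
          by case: (v == w).
        by rewrite cardsU1; case: (_ \notin _); move: lt2; lia.
      apply: leq_trans (fibh u); apply/subset_leq_card/subsetP => v.
      by rewrite !inE ffunE; case: (v == w) => //; rewrite eq_sym (negbTE uw1).
    - by rewrite ffunE (negbTE (hcyc x _)) ?hx ?hy.
    - by rewrite ffunE (negbTE (hcyc y _)) ?hx ?hy.
  have := hmax h' ok'; rewrite /= leqNgt => /negP[].
  apply/proper_card/properP; split.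
    apply/subsetP => v; rewrite !inE => /eqP hhv.
    rewrite ![h' _]ffunE (negbTE (hcyc v hhv)).
    by rewrite (negbTE (hcyc (h v) _)) ?hhv.
  by exists w; rewrite !inE // ![h' _]ffunE eqxx (negbTE w1w) hw1.
pose B := [set w | (h (h w) != w) && [exists v, h v == w]].
pose P := [set v | h v \in B].
have sPB : P \subset B.
  apply/subsetP => v; rewrite !inE => /andP[nc _]; apply/andP; split.
    by apply: contra nc => /eqP->.
  have := two (h v) v nc erefl => c2.
  have /card_gt0P[u] : 0 < #|[set u | h u == v]| by rewrite c2.
  by rewrite inE => hu; apply/existsP; exists u.
have cardP (C : {set T}) : #|[set v | h v \in C]| = \sum_(w in C) #|[set v | h v == w]|.
  rewrite -sum1_card (partition_big h (mem C)) /=; last by move=> v; rewrite inE.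
  apply: eq_bigr => w wC; rewrite -sum1_card; apply: eq_bigl => v; rewrite !inE.
  by case: eqP => [->|]; rewrite ?wC ?andbF.
(* Members of [B] have preimages, so [sPB] becomes an equality. Each [w] in [B] is then itself a
   preimage of a member of [B], hence has exactly two preimages, and the count doubles. *)
have leBP : #|B| <= #|P|.
  rewrite (cardP B) -sum1_card; apply: leq_sum => w; rewrite inE => /andP[_ /existsP[v hv]].
  by apply/card_gt0P; exists v; rewrite inE.
have PB : P = B by apply/eqP; rewrite eqEcard sPB.
have B0 : B = set0.
  apply/eqP; rewrite -cards_eq0; have : #|P| = 2 * #|B|; last by rewrite PB; lia.
  rewrite (cardP B) mulnC -sum_nat_const; apply: eq_bigr => w.
  rewrite -{1}PB inE => hwB; apply: (two (h w)) => //.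
  by move: hwB; rewrite inE => /andP[].
move=> v; apply/eqP/negPn/negP => nc.
have : h v \in B by rewrite inE nc; apply/existsP; exists v.
by rewrite B0 inE.
Qed.

Lemma seq_adj_cons2 (T : eqType) (s : seq T) (u v x y : T) :
  seq_adj (u :: v :: s) x y <->
  ((u = x /\ v = y) \/ (u = y /\ v = x)) \/ seq_adj (v :: s) x y.
Proof.
split=> [[[|i] lti /= e]|[e|[i lti e]]]; [by left| | by exists 0 |by exists i.+1].
by right; exists i.
Qed.

Lemma seq_adj1 (T : eqType) (u x y : T) : ~ seq_adj [:: u] x y.
Proof. by case=> i. Qed.

(* The components are the 2-cycles of [f] with the remaining preimages of
   their two vertices attached: paths with 2, 3 or 4 vertices. *)
Lemma path_factor_of_two_cycles (n : nat) (g : rel 'I_n) (f : 'I_n -> 'I_n) :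
  simple_graph g -> (forall v, g v (f v)) ->
  (forall u, #|[set v | f v == u]| <= 2) -> (forall v, f (f (f v)) = f v) ->
  P_ge_k_factor g 2 [rel u v | (f u == v) || (f v == u)].
Proof.
move=> [gsym girr] gf fib fff; split; first by move=> u v /=; rewrite orbC.
split; first by move=> u v /= /orP[] /eqP <- //; rewrite gsym.
have fneq v : f v != v by apply/eqP => e; have := gf v; rewrite e girr.
pose leaves r := enum [set u | (f u == r) && (u != f r)].
have leavesE r u : (u \in leaves r) = (f u == r) && (u != f r) by rewrite mem_enum inE.
have size_leaves r : f (f r) = r -> size (leaves r) <= 1.
  move=> ffr; rewrite -cardE; have := fib r; rewrite (cardsD1 (f r)) inE ffr eqxx.
  rewrite ltnS; apply: leq_trans; apply/subset_leq_card/subsetP => u.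
  by rewrite !inE andbC.
have leaf r w : w \in leaves r -> f (f r) = r -> f w = r /\ (forall u, f u != w).
  rewrite leavesE => /andP[/eqP fw wn] ffr; split=> // u.
  by apply: contra wn => /eqP fu; rewrite -fw -fu fff.
have comp r : f (f r) = r -> forall w, f w \in [:: r; f r] ->
    exists s, [/\ w \in s, uniq s, 2 <= size s &
      forall x y, x \in s -> ((f x == y) || (f y == x)) <-> seq_adj s x y].
  move=> ffr w fw.
  pose s := leaves r ++ [:: r; f r] ++ leaves (f r).
  have ll u r1 : f u = r1 -> u = f r1 \/ u \in leaves r1.
    move=> fu; have [->|un] := eqVneq u (f r1); first by left.
    by right; rewrite leavesE fu eqxx.
  have lr u : f u = r -> u = f r \/ u \in leaves r by apply: ll.
  have lr' u : f u = f r -> u = r \/ u \in leaves (f r) by move/ll; rewrite ffr.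
  have rr' : r != f r by rewrite eq_sym.
  have szr' : size (leaves (f r)) <= 1 by apply: size_leaves; rewrite ffr.
  have ws : w \in s.
    rewrite !mem_cat; move: fw; rewrite !inE => /orP[]/eqP.
      by case/lr => ->; rewrite ?eqxx ?orbT.
    by case/lr' => ->; rewrite ?eqxx ?orbT.
  have us : uniq s.
    have dis z : z \in leaves r -> z \notin [:: r; f r] ++ leaves (f r).
      move=> zl; have [fz nz] := leaf r z zl ffr.
      rewrite mem_cat !inE leavesE fz; apply/negP => /orP[/orP[]/eqP zE|/andP[/eqP rE]].
      - by have := nz (f r); rewrite ffr zE eqxx.
      - by have := nz r; rewrite zE eqxx.
      by move: rr'; rewrite {1}rE eqxx.
    rewrite cat_uniq; apply/and3P; split; first exact: enum_uniq.
      by apply/hasPn => z zs; apply/negP => /dis; rewrite zs.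
    rewrite /= enum_uniq inE negb_or rr' andbT /=; apply/andP; split; apply/negP.
      by rewrite leavesE ffr !eqxx.
    by rewrite leavesE ffr (negbTE rr').
  exists s; split=> //; first by rewrite !size_cat /= addnCA leq_addr.
  have fo u v : (f u == v) || (f v == u) <-> f u = v \/ f v = u.
    by split=> [/orP[]/eqP|[]->]; rewrite ?eqxx ?orbT; auto.
  have lf z : z \in leaves r -> f z = r /\ forall u, f u <> z.
    by move=> zl; have [? nz] := leaf r z zl ffr; split=> // u; apply/eqP.
  have lf' z : z \in leaves (f r) -> f z = f r /\ forall u, f u <> z.
    by move=> zl; have [? nz] := leaf _ z zl (congr1 f ffr); split=> // u; apply/eqP.
  (* With at most one leaf at either end, [s] has four possible shapes. In each one the preimages of
     all its vertices are known, which settles adjacency by congruence. *)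
  move=> u v us'; rewrite fo; move: us' (size_leaves r ffr) szr' lr lr' lf lf'; rewrite /s.
  case: (leaves r) => [|a []] //; case: (leaves (f r)) => [|b []] //=;
    rewrite !inE !seq_adj_cons2 => us' _ _ lr lr' lf lf'.
  - have {}lr z : f z = r -> z = f r by case/lr.
    have {}lr' z : f z = f r -> z = r by case/lr'.
    have := @seq_adj1 _ (f r) u v.
    have := lr v; have := lr' v.
    clear - rr' us' ffr; move/eqP: rr' => rr'.
    by case/orP: us' => /eqP->; intuition congruence.
  - have {}lr z : f z = r -> z = f r by case/lr.
    have {}lr' z : f z = f r -> z = r \/ z = b by case/lr' => [|/[!inE]/eqP]; auto.
    have [fb nb] := lf' b (mem_head _ _).
    have := @seq_adj1 _ b u v.
    have := nb u; have := nb v; have := lr v; have := lr' v.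
    clear - rr' us' ffr fb; move/eqP: rr' => rr'.
    by case/or3P: us' => /eqP->; intuition congruence.
  - have {}lr z : f z = r -> z = f r \/ z = a by case/lr => [|/[!inE]/eqP]; auto.
    have [fa na] := lf a (mem_head _ _).
    have {}lr' z : f z = f r -> z = r by case/lr'.
    have := @seq_adj1 _ (f r) u v.
    have := na u; have := na v; have := lr v; have := lr' v.
    clear - rr' us' ffr fa; move/eqP: rr' => rr'.
    by case/or3P: us' => /eqP->; intuition congruence.
  - have {}lr z : f z = r -> z = f r \/ z = a by case/lr => [|/[!inE]/eqP]; auto.
    have [fa na] := lf a (mem_head _ _).
    have {}lr' z : f z = f r -> z = r \/ z = b by case/lr' => [|/[!inE]/eqP]; auto.
    have [fb nb] := lf' b (mem_head _ _).
    have := @seq_adj1 _ b u v.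
    have := na u; have := na v; have := nb u; have := nb v; have := lr v; have := lr' v.
    clear - rr' us' ffr fa fb; move/eqP: rr' => rr'.
    by case/or4P: us' => /eqP->; intuition congruence.
(* Either [v] lies on a 2-cycle or it is a leaf attached to one at [f v]. *)
move=> v; have [ffv|ffv] := eqVneq (f (f v)) v.
  by apply: (comp v) => //; rewrite !inE eqxx orbT.
by apply: (comp (f v)); rewrite ?fff // !inE eqxx.
Qed.

(** Hall's theorem assigns images to the vertices of [D]. Each vertex is offered in two copies,
    tagged by a boolean, except [x] and [y], which get one copy because each is already the image of
    the other. *)
Lemma exists_exchanging_map (n : nat) (g : rel 'I_n) (x y : 'I_n) :
  simple_graph g -> g x y ->
  (forall S I : {set 'I_n}, [disjoint S & I] ->
    (forall v u, v \in I -> g v u -> u \in S) ->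
    #|I| <= (#|S| + #|S :\: [set x; y]|)) ->
  exists f : 'I_n -> 'I_n, [/\ forall v, g v (f v),
    forall u, #|[set v | f v == u]| <= 2, f x = y & f y = x].
Proof.
move=> [gsym girr] gxy tough.
have xy : x != y by apply: contraTneq gxy => ->; rewrite girr.
pose D := ~: [set x; y].
pose A := [ffun v => [set p : 'I_n * bool | g v p.1 && (p.2 ==> (p.1 \in D))]].
have [X sXD|h [hinj hA]] := @hall_marriage _ _ (x, true) D A.
  (* [I] collects the vertices isolated within [X]. By symmetry of [g] the others are neighbours of
     [X] themselves, so they pay for their own share in Hall's condition; the two copies of the
     vertices of [S] pay for [I], by [tough]. *)
  pose I := [set v in X | [forall u in X, ~~ g v u]].
  pose S := [set u | [exists v in I, g v u]].
  set N := \bigcup_(t in X) A t.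
  have NE u b : (u, b) \in N = [exists v in X, g v u] && (b ==> (u \in D)).
    apply/bigcupP/andP => [[v vX]|[/exists_inP[v vX gvu] ub]].
      rewrite ffunE inE /= => /andP[gvu ->]; split=> //.
      by apply/exists_inP; exists v.
    by exists v => //; rewrite ffunE inE gvu.
  have dSX : [disjoint S & X].
    rewrite disjoint_subset; apply/subsetP => u; rewrite !inE => /exists_inP[v].
    rewrite inE => /andP[vX /forall_inP nv] gvu; apply/negP => uX.
    by have := nv u uX; rewrite gvu.
  have leI : #|I| <= #|S| + #|S :\: [set x; y]|.
    apply: tough.
      by apply: disjointWr dSX; apply/subsetP => v; rewrite inE => /andP[].
    by move=> v u vI gvu; rewrite inE; apply/exists_inP; exists v.
  have sub : [set (u, false) | u in S :|: (X :\: I)]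
      :|: [set (u, true) | u in S :\: [set x; y]] \subset N.
    apply/subsetP => p /setUP[] /imsetP[u uS ->]; rewrite NE.
      case/setUP: uS; rewrite !inE.
        case/exists_inP => v; rewrite inE => /andP[vX _] gvu; rewrite andbT.
        by apply/exists_inP; exists v.
      case/andP=> + uX; rewrite uX /= => /forall_inPn[v vX]; rewrite negbK => guv.
      by rewrite andbT; apply/exists_inP; exists v; rewrite // gsym.
    case/setDP: uS; rewrite inE => /exists_inP[v]; rewrite inE => /andP[vX _] gvu uxy.
    rewrite [u \in D]inE uxy andbT.
    by apply/exists_inP; exists v.
  apply: leq_trans (subset_leq_card sub).
  rewrite cardsU disjoint_setI0 ?cards0 ?subn0; last first.
    rewrite disjoint_subset; apply/subsetP => p /imsetP[u _ ->].
    by rewrite !inE; apply/imsetP => -[].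
  rewrite !card_imset; try by move=> ? ? [].
  rewrite cardsU (_ : S :&: (X :\: I) = set0) ?cards0 ?subn0; last first.
    by apply/disjoint_setI0/(disjointWr _ dSX)/subsetDl.
  have := cardsID I X; have := subset_leq_card (subsetIr X I); lia.
pose f v := if v == x then y else if v == y then x else (h v).1.
have fx : f x = y by rewrite /f eqxx.
have fy : f y = x by rewrite /f eqxx eq_sym (negbTE xy).
have fD v : v \in D -> f v = (h v).1.
  by rewrite !inE negb_or /f => /andP[/negbTE-> /negbTE->].
exists f; split=> //.
  move=> v; have [vD|] := boolP (v \in D).
    by rewrite fD //; have := hA v vD; rewrite ffunE inE => /andP[].
  by rewrite !inE negbK => /orP[]/eqP->; rewrite ?fx ?fy // gsym.
move=> u.
have fibD : #|[set v in D | f v == u]| <= 1 + (u \in D).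
  rewrite -(card_in_imset (f := h)) => [|v1 v2]; last first.
    by rewrite !inE => /andP[v1D _] /andP[v2D _]; apply: hinj; rewrite inE ?inE.
  pose C := [set (u, false)] :|: (if u \in D then [set (u, true)] else set0).
  apply: leq_trans (_ : #|C| <= _).
    apply/subset_leq_card/subsetP => p /imsetP[v]; rewrite inE => /andP[vD /eqP fv] ->.
    have := hA v vD; rewrite fD // in fv; rewrite ffunE inE; case: (h v) fv => w b /= ->.
    by rewrite /C; case: b => /andP[_ /=] => [->|_]; rewrite !inE eqxx ?orbT.
  apply: leq_trans (leq_card_setU _ _) _; rewrite cards1.
  by case: (u \in D); rewrite ?cards1 ?cards0.
(* A vertex of [D] is hit only from [D], at most once per copy; [x] and [y] are hit at most once
   from [D] and once by each other. *)
have [uxy|uxy] := boolP (u \in D).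
  rewrite uxy in fibD; apply: leq_trans fibD; apply/subset_leq_card/subsetP => v.
  rewrite !inE => /eqP fv; rewrite fv eqxx andbT; apply/negP.
  move=> vxy; move: uxy; rewrite -fv !inE.
  by case/orP: vxy => /eqP->; rewrite ?fx ?fy eqxx ?orbT.
rewrite (negbTE uxy) addn0 in fibD; rewrite -(cardsID D).
apply: (@leq_add _ _ 1 1).
  apply: leq_trans fibD; apply/subset_leq_card/subsetP => v; rewrite !inE.
  by case/andP=> ? ?; apply/andP.
apply: leq_trans (_ : #|[set f u]| <= 1); last by rewrite cards1.
apply/subset_leq_card/subsetP => v; rewrite !inE negbK andbC => /andP[/eqP <-].
by case/orP => /eqP->; rewrite ?fx ?fy ?fx ?fy.
Qed.

(** * Spectral bounds from positive test vectors *)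

Local Open Scope ring_scope.

(** Pair the absolute values of a left eigenvector [v] with [x]: the triangle inequality bounds
    [mu * w] by the sum of all [|v_i| M_ij x_j], the hypothesis on [x] bounds that sum by [lam * w],
    and [w] is positive. *)
Lemma eigenvalue_le_pos_vector (R : realFieldType) (n : nat) (M : 'M[R]_n)
    (x : 'I_n -> R) (lam mu : R) :
  (forall i j, 0 <= M i j) -> (forall i, 0 < x i) ->
  (forall i, \sum_j M i j * x j <= lam * x i) ->
  eigenvalue M mu -> mu <= lam.
Proof.
move=> M_ge0 x_gt0 Mx /eigenvalueP[v vM v_neq0].
have {v_neq0} [i0 vi0] : exists i, v ord0 i != 0.
  apply/existsP; apply: contraR v_neq0; rewrite negb_exists => /forallP v0.
  by apply/eqP/rowP => i; rewrite mxE; apply/eqP; rewrite -[_ == _]negbK v0.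
pose w := \sum_i `|v ord0 i| * x i.
have w_gt0 : 0 < w.
  rewrite /w (bigD1 i0) //= ltr_wpDr ?mulr_gt0 ?normr_gt0 //.
  by apply: sumr_ge0 => i _; rewrite mulr_ge0 // ltW.
rewrite -(ler_pM2r w_gt0) /w !mulr_sumr.
apply: (@le_trans _ _ (\sum_j \sum_i `|v ord0 i| * M i j * x j)).
  apply: ler_sum => j _; rewrite mulrA -mulr_suml; apply: ler_wpM2r; first exact: ltW.
  have -> : \sum_i `|v ord0 i| * M i j = \sum_i `|v ord0 i * M i j|.
    by apply: eq_bigr => i _; rewrite normrM (ger0_norm (M_ge0 i j)).
  apply: le_trans (ler_norm_sum _ _ _).
  have := congr1 (fun u : 'rV_n => u ord0 j) vM; rewrite !mxE => ->.
  by rewrite normrM ler_wpM2r // ler_norm.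
rewrite exchange_big /=; apply: ler_sum => i _.
under eq_bigr do rewrite -mulrA.
by rewrite -mulr_sumr mulrCA ler_wpM2l.
Qed.

(* The quotient inequalities are those of [K_s \/ (K_m u k K_1)], of which [g]
   is a spanning subgraph. *)
Lemma A_alpha_eigenvalue_le (R : realFieldType) (n : nat) (g : rel 'I_n)
    (alpha lam mu a b c : R) (S I : {set 'I_n}) (m : nat) :
  0 <= alpha -> alpha <= 1 -> simple_graph g ->
  [disjoint S & I] -> (forall v u, v \in I -> g v u -> u \in S) ->
  (#|S| + #|I| + m)%N = n ->
  0 < a -> 0 < b -> 0 < c ->
  alpha * n.-1%:R * a
    + (1 - alpha) * (#|S|%:R * a + #|I|%:R * c + m%:R * b - a) <= lam * a ->
  alpha * (n.-1%:R - #|I|%:R) * b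
    + (1 - alpha) * (#|S|%:R * a + m%:R * b - b) <= lam * b ->
  alpha * #|S|%:R * c + (1 - alpha) * (#|S|%:R * a) <= lam * c ->
  eigenvalue (A_alpha g alpha) mu -> mu <= lam.
Proof.
move=> a_ge0 a_le1 [gsym girr] dSI INS card_n a_gt0 b_gt0 c_gt0 rowS rowR rowI.
pose x v := if v \in S then a else if v \in I then c else b.
have x_gt0 v : 0 < x v by rewrite /x; case: ifP => // _; case: ifP.
(* As [x] is positive, replacing the neighbourhood of [v] by a larger set [N] only increases the row
   sum. Below, [N] is the neighbourhood of [v] in the extremal graph. *)
have xle (v : 'I_n) (N : {set 'I_n}) : (forall u, g v u -> u \in N) ->
    \sum_j A_alpha g alpha v j * x j
    <= alpha * #|N|%:R * x v + (1 - alpha) * \sum_(u in N) x u.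
  move=> gN.
  have -> : \sum_j A_alpha g alpha v j * x j =
      alpha * (deg g v)%:R * x v + (1 - alpha) * \sum_(u | g v u) x u.
    under eq_bigr do rewrite mxE mulrDl.
    rewrite big_split /=; congr (_ + _).
      rewrite (bigD1 v) //= eqxx mul1r big1 ?addr0 // => u.
      by rewrite eq_sym => /negbTE->; rewrite mul0r mulr0 mul0r.
    rewrite mulr_sumr [RHS]big_mkcond /=; apply: eq_bigr => u _.
    by case: (g v u); rewrite ?mulr1 // mulr0 mul0r.
  apply: lerD.
    apply: ler_wpM2r; first exact: ltW.
    apply: ler_wpM2l => //; rewrite ler_nat; apply: subset_leq_card.
    by apply/subsetP => u; rewrite inE; apply: gN.
  apply: ler_wpM2l; first by rewrite subr_ge0.
  rewrite big_mkcond [leRHS]big_mkcond; apply: ler_sum => u _.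
  by case: ifP => [/gN->|_] //; case: ifP => // _; apply: ltW.
have sumS : \sum_(u in S) x u = #|S|%:R * a.
  rewrite mulr_natl -sumr_const; apply: eq_bigr => u uS.
  by rewrite /x uS.
have sumI : \sum_(u in I) x u = #|I|%:R * c.
  rewrite mulr_natl -sumr_const; apply: eq_bigr => u uI.
  by rewrite /x uI (disjointFl dSI).
have cardC : #|~: I :\: S| = m.
  have -> : ~: I :\: S = ~: (S :|: I) by rewrite setCU setDE setIC.
  have := cardsC (S :|: I); rewrite cardsU (disjoint_setI0 dSI) cards0 card_ord.
  by lia.
have sumR : \sum_(u in ~: I :\: S) x u = m%:R * b.
  rewrite mulr_natl -cardC -sumr_const; apply: eq_bigr => u.
  by rewrite !inE /x => /andP[/negbTE-> /negbTE->].
have sumIC : \sum_(u in ~: I) x u = #|S|%:R * a + m%:R * b.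
  rewrite (big_setID S) /= sumR; congr (_ + _); rewrite -sumS.
  apply: eq_bigl => u; rewrite !inE; case: (boolP (u \in S)) => uS; last by rewrite andbF.
  by rewrite (disjointFr dSI).
have sumT : \sum_(u : 'I_n) x u = #|S|%:R * a + #|I|%:R * c + m%:R * b.
  rewrite (bigID (mem I)) /= sumI.
  have -> : \sum_(i | i \notin I) x i = \sum_(u in ~: I) x u.
    by apply: eq_bigl => u; rewrite inE.
  by rewrite sumIC; ring.
apply: (@eigenvalue_le_pos_vector _ _ _ x) => // [i j|v].
  by rewrite mxE addr_ge0 // !mulr_ge0 // subr_ge0.
have gvv u : g v u -> u != v by apply: contraTneq => ->; rewrite girr.
have [vS|vS] := boolP (v \in S).
  have := xle v [set~ v].
  rewrite cardsC1 card_ord => /(_ _)/le_trans-> //.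
    by move=> u /gvv; rewrite !inE.
  have -> : \sum_(u in [set~ v]) x u = \sum_u x u - x v.
    rewrite [in RHS](bigD1 v) //= addrC addrK; apply: eq_bigl => u.
    by rewrite !inE.
  by rewrite sumT /x vS.
have [vI|vI] := boolP (v \in I).
  have := xle v S => /(_ _)/le_trans-> //; first by move=> u; apply: INS.
  by rewrite sumS /x (negbTE vS) vI.
have := xle v (~: I :\ v) => /(_ _)/le_trans-> //.
  move=> u gvu; rewrite !inE gvv //=; apply: contra vS => uI.
  by apply: (INS u) => //; rewrite gsym.
have -> : \sum_(u in ~: I :\ v) x u = \sum_(u in ~: I) x u - x v.
  by rewrite [in RHS](big_setD1 v) /= ?inE // addrC addrK.
have -> : #|~: I :\ v|%:R = n.-1%:R - #|I|%:R :> R.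
  have := cardsD1 v (~: I); have := cardsC I; rewrite inE vI card_ord => e1 e2.
  have e3 : n.-1 = (#|I| + #|~: I :\ v|)%N.
    by move: e1; rewrite e2 /= add1n addnS => /(congr1 predn) <-.
  by rewrite e3 natrD addrC addKr.
by rewrite sumIC /x (negbTE vS) (negbTE vI).
Qed.

(** * The cubic and the lower bound on the order *)

(* The determinant of the quotient matrix of [K_1 \/ (K_(n-3) u 2 K_1)],
   expanded along the row of [K_1]. *)
Lemma horner_eta_poly (R : comNzRingType) (alpha x : R) (n : nat) :
  (eta_poly alpha n).[x] =
  (x - alpha) * ((x - alpha * (n%:R - 1)) * (x - n%:R + 4 - alpha)
                 - (1 - alpha) ^+ 2 * (n%:R - 3))
  - 2 * (1 - alpha) ^+ 2 * (x - n%:R + 4 - alpha).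
Proof. by rewrite /eta_poly !hornerE /=; ring. Qed.

(** The cubic is nonpositive at [n - 3] and nonnegative at [n], so it has a root between them. *)
Lemma largest_root_eta_poly_ge (R : rcfType) (alpha eta : R) (n : nat) :
  0 <= alpha -> alpha < 1 -> (4 <= n)%N ->
  largest_root (eta_poly alpha n) eta -> n%:R - 3 <= eta.
Proof.
move=> a_ge0 a_lt1 n_ge4 [_ eta_max].
have N_ge4 : 4 <= n%:R :> R by rewrite ler_nat.
have lo : (eta_poly alpha n).[n%:R - 3] <= 0.
  rewrite horner_eta_poly.
  have -> : forall N : R, (N - 3 - alpha) * ((N - 3 - alpha * (N - 1)) * (N - 3 - N + 4 - alpha)
      - (1 - alpha) ^+ 2 * (N - 3)) - 2 * (1 - alpha) ^+ 2 * (N - 3 - N + 4 - alpha)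
      = - (2 * (alpha * (1 - alpha) * (N - 3 - alpha)) + 2 * (1 - alpha) ^+ 3).
    by move=> N; ring.
  rewrite oppr_le0 addr_ge0 // mulr_ge0 //; last by rewrite exprn_ge0 // subr_ge0 ltW.
  by rewrite !mulr_ge0 //; lra.
have hi : 0 <= (eta_poly alpha n).[n%:R].
  rewrite horner_eta_poly; set N := n%:R in N_ge4 *.
  have -> : (N - alpha) * ((N - alpha * (N - 1)) * (N - N + 4 - alpha)
      - (1 - alpha) ^+ 2 * (N - 3)) - 2 * (1 - alpha) ^+ 2 * (N - N + 4 - alpha)
      = (N - alpha) * (alpha * (4 - alpha) + 3 * (1 - alpha) ^+ 2)
      + (1 - alpha) * (3 * N * (N - alpha) - 2 * (1 - alpha) * (4 - alpha)).
    by ring.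
  apply: addr_ge0; apply: mulr_ge0; try lra.
    by apply: addr_ge0; apply: mulr_ge0; rewrite ?exprn_ge0 //; lra.
  by nra.
have [||x /andP[x_ge _] x_root] :=
    @Num.Theory.poly_ivt _ (eta_poly alpha n) (n%:R - 3) n%:R; rewrite ?lo //.
  by rewrite gerBl.
exact: le_trans x_ge (eta_max _ x_root).
Qed.

(** The second inequality says [n >= 13/2 + 3/(1 - alpha)], which the case [#|S| >= 2] needs. On the
    first three ranges [1/(1 - alpha)] is at most 2, 3 and 4; on the last it exceeds 4. *)
Lemma n_ge_of_f_alpha (R : realFieldType) (alpha : R) (n : nat) :
  0 <= alpha -> alpha < 1 -> f_alpha alpha <= n%:R ->
  (14 <= n)%N /\ 6 + 13 * (1 - alpha) <= 2 * (1 - alpha) * n%:R.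
Proof.
move=> a_ge0 a_lt1 fn.
suff [N14 ?] : 14 <= n%:R :> R /\ 6 + 13 * (1 - alpha) <= 2 * (1 - alpha) * n%:R.
  by split=> //; rewrite -(ler_nat R).
move: fn; rewrite /f_alpha; set N := n%:R.
case: (lerP alpha 2^-1) => h1; first by move=> hN; split; [lra|nra].
case: (lerP alpha (2/3)) => h2; first by move=> hN; split; [lra|nra].
case: (lerP alpha (3/4)) => h3; first by move=> hN; split; [lra|nra].
rewrite -lerBrDr ler_pdivrMr ?subr_gt0 // => hN.
by split; nra.
Qed.

Lemma eigenvalue_A_alpha_le_eta (R : rcfType) (n : nat) (g : rel 'I_n)
    (alpha eta rho : R) (S I : {set 'I_n}) :
  0 <= alpha -> alpha < 1 -> simple_graph g -> f_alpha alpha <= n%:R ->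
  largest_root (eta_poly alpha n) eta -> eigenvalue (A_alpha g alpha) rho ->
  [disjoint S & I] -> (forall v u, v \in I -> g v u -> u \in S) ->
  (if #|S| == 1 then 2 <= #|I| else (2 <= #|S|) && (2 * #|S| <= #|I| + 1))%N ->
  rho <= eta.
Proof.
move=> a_ge0 a_lt1 gs fn eta_root eig dSI INS cardSI.
have [n14 nbeta] := n_ge_of_f_alpha _ _ _ a_ge0 a_lt1 fn.
have n4 : (4 <= n)%N by apply: leq_trans n14.
have eta_ge := largest_root_eta_poly_ge _ _ _ _ a_ge0 a_lt1 n4 eta_root.
have a_le1 := ltW a_lt1.
pose m := (n - (#|S| + #|I|))%N.
have leSI : (#|S| + #|I| <= n)%N.
  have := max_card (mem (S :|: I)); rewrite card_ord cardsU (disjoint_setI0 dSI) cards0.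
  by rewrite subn0.
have card_n : (#|S| + #|I| + m)%N = n by rewrite subnKC.
have N14 : 14 <= n%:R :> R by rewrite ler_nat.
have n1E : n.-1%:R = n%:R - 1 :> R by rewrite -subn1 natrB // (leq_trans _ n14).
have nE : n%:R = #|S|%:R + #|I|%:R + m%:R :> R by rewrite -!natrD card_n.
have mE : m%:R = n%:R - #|S|%:R - #|I|%:R :> R by rewrite nE; ring.
have m_ge0 : 0 <= m%:R :> R by rewrite ler0n.
case: eqP cardSI => [S1 I2 | _ /andP[S2 SI]].
  have k_ge2 : 2 <= #|I|%:R :> R by rewrite ler_nat.
  have := eta_root.1; rewrite rootE horner_eta_poly => /eqP eta_eq.
  (* With [#|I| = 2] and [lam = eta], the rows of the remaining vertices and of [I] read
     [(1 - alpha) a = d b] and [(1 - alpha) a = d' c], which fixes the vector up to scaling; the row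
     of [S] is then the cubic equation. *)
  pose d := eta - n%:R + 4 - alpha; pose d' := eta - alpha.
  have d_gt0 : 0 < d by rewrite /d; lra.
  have d'_gt0 : 0 < d' by rewrite /d'; lra.
  apply: (@A_alpha_eigenvalue_le _ _ g alpha _ _
      (d * d') ((1 - alpha) * d') ((1 - alpha) * d) S I m) => //;
    rewrite ?n1E ?mE ?S1; try (by rewrite mulr_gt0 // subr_gt0); try by rewrite mulr_gt0.
  (* The slack left by a larger [I] comes from [b - c = (1 - alpha) (d' - d)], where
     [d' - d = n - 4]. *)
  - rewrite -subr_ge0 [leRHS](_ : _ =
      (1 - alpha) ^+ 2 * (#|I|%:R - 2) * (n%:R - 4)).
      by rewrite !mulr_ge0 ?exprn_ge0 ?subr_ge0 //; lra.
    by rewrite -[RHS]addr0 -eta_eq /d /d'; ring.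
  - rewrite -subr_ge0 [leRHS](_ : _ = (1 - alpha) * d' * (#|I|%:R - 2)).
      by rewrite !mulr_ge0 ?subr_ge0 //; lra.
    by rewrite /d /d'; ring.
  - by rewrite le_eqVlt; apply/orP; left; apply/eqP; rewrite /d /d'; ring.
have s_ge2 : 2 <= #|S|%:R :> R by rewrite ler_nat.
have ks : 2 * #|S|%:R <= #|I|%:R + 1 :> R.
  by rewrite -natrM natr1 ler_nat; move: SI; rewrite addn1.
apply: le_trans eta_ge.
apply: (@A_alpha_eigenvalue_le _ _ g alpha _ _
    (1 + 2 * (1 - alpha)) (2 * (1 - alpha)) (2 * (1 - alpha)) S I m) => //;
  rewrite ?n1E ?mE; try lra.
(* From [2 #|S| <= #|I| + 1] and [#|S| + #|I| <= n] follows [3 (n - #|S|) >= 2 n - 1]; three times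
   the slack is then nonnegative exactly by [nbeta]. *)
- rewrite -subr_ge0 [leRHS](_ : _ =
    (1 - alpha) * (n%:R - #|S|%:R) - 2 - 4 * (1 - alpha)); last by ring.
  have : (1 - alpha) * (2 * n%:R - 1) <= (1 - alpha) * (3 * (n%:R - #|S|%:R)).
    by apply: ler_wpM2l; lra.
  by lra.
- rewrite -subr_ge0 [leRHS](_ : _ =
    (1 - alpha) * (2 * #|I|%:R - #|S|%:R - 4)); last by ring.
  by apply: mulr_ge0; lra.
- rewrite -subr_ge0 [leRHS](_ : _ =
    (1 - alpha) * (2 * n%:R - 6 - 3 * #|S|%:R)); last by ring.
  by apply: mulr_ge0; lra.
Qed.

Theorem theorem1p2 (R : realType) (alpha : R) (n : nat) (g : rel 'I_n)
    (rho eta : R) :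
  0 <= alpha -> alpha < 1 ->
  simple_graph g -> connected_graph g ->
  f_alpha alpha <= n%:R ->
  largest_eigenvalue (A_alpha g alpha) rho ->
  largest_root (eta_poly alpha n) eta ->
  eta < rho ->
  P_ge_k_factor_covered g 2.
Proof.
move=> a_ge0 a_lt1 gs gconn fn [eig _] eta_root lt_eta x y gxy.
have [gsym girr] := gs.
have [||f0 [gf0 fib0 f0x f0y]] := @exists_exchanging_map n g x y gs => // [S I dSI INS|].
  rewrite leqNgt; apply/negP => ltI.
  have S_gt0 : (0 < #|S|)%N.
    (* If [S] were empty, a vertex of [I] would be isolated, so by connectedness it would be [x],
       which has the neighbour [y]. *)
    rewrite lt0n; apply/negP; rewrite cards_eq0 => /eqP S0.
    have /card_gt0P[v vI] : (0 < #|I|)%N by apply: leq_trans ltI.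
    have nv u : ~~ g v u by apply/negP => /(INS v u vI); rewrite S0 inE.
    have vx : v = x.
      have /connectP[[|u p] /= ] := gconn v x; first by [].
      by rewrite (negbTE (nv u)).
    by have := nv y; rewrite vx gxy.
  move: lt_eta; rewrite ltNge => /negP[].
  apply: (@eigenvalue_A_alpha_le_eta _ _ g alpha _ _ S I) => //.
  (* At most [min(2, #|S|)] vertices of [S] lie in [[set x; y]], so [ltI] yields [#|I| >= 2] when
     [#|S| = 1] and [#|I| >= 2 #|S| - 1] otherwise. *)
  have cardSxy := cardsID [set x; y] S.
  have : (#|S :&: [set x; y]| <= 2)%N.
    by rewrite (leq_trans (subset_leq_card (subsetIr _ _))) // cards2; case: eqP.
  move: ltI S_gt0 cardSxy; move: #|I| #|S| #|_ :\: _| #|_ :&: _| => i s d k.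
  by case: (s =P 1%N) => [->|s_neq1] *; [|apply/andP; split]; lia.
have [f [gf fib fx fy fff]] := two_cycle_map _ _ _ _ _ gsym gf0 fib0 f0x f0y.
exists [rel u v | (f u == v) || (f v == u)]; split; last by rewrite /= fx eqxx.
exact: path_factor_of_two_cycles.
Qed.
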